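(* Assume that $\mathbb{F}$ is algebraically closed and $q$ is not a root of unity. If $V$ is a finite-dimensional irreducible $\mathfrak{H}_q$-module, then the following (i) or (ii) holds: (i) $t_0$ and $t_1$ have a simultaneous eigenvector in $V$. (ii) $t_2$ and $t_3$ have a simultaneous eigenvector in $V$.
   Context: $\mathbb{F}$ is a field and $q\in\mathbb{F}$ is nonzero. The universal DAHA $\mathfrak{H}_q$ of type $(C_1^\vee,C_1)$ is the unital associative $\mathbb{F}$-algebra with generators $t_0^{\pm1},t_1^{\pm1},t_2^{\pm1},t_3^{\pm1}$ and relations: $t_it_i^{-1}=t_i^{-1}t_i=1$ for all $i$; $t_i+t_i^{-1}$ is central for all $i$; $t_0t_1t_2t_3=q^{-1}$. A simultaneous eigenvector of two elements is a nonzero vector that is an eigenvector of both. *)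

(* Defs.v *)
From HB Require Import structures.
From mathcomp Require Import all_boot all_order all_algebra.
From mathcomp Require Import boolp.

Set Implicit Arguments.
Unset Strict Implicit.
Unset Printing Implicit Defensive.

Import GRing.Theory.
Local Open Scope ring_scope.
Local Open Scope quotient_scope.

(* Noncommutative polynomial expressions in t_i (Gen i) and t_i^-1 (GenV i),   *)
(* i = 0, ..., 3, with coefficients in F. Numerals of type 'I_4 are taken in   *)
(* the ring Z/4Z, so 0, 1, 2, 3 : 'I_4 are the four indices.                   *)
Inductive expr (F : Type) : Type :=
| Cst of F
| Gen of 'I_4
| GenV of 'I_4
| Add of expr F & expr F
| Mul of expr F & expr F.

Arguments Gen {F} i.
Arguments GenV {F} i.

(* The least congruence that contains the laws of unital associative           *)
(* F-algebras and the defining relations of the universal DAHA. The opposite   *)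
(* of x is (-1) x, so the additive group law x - x = 0 comes from daha_mul0.   *)
Inductive daha_eq (F : fieldType) (q : F) : expr F -> expr F -> Prop :=
| daha_refl x : daha_eq q x x
| daha_sym x y : daha_eq q x y -> daha_eq q y x
| daha_trans x y z : daha_eq q x y -> daha_eq q y z -> daha_eq q x z
| daha_addl x y z : daha_eq q x y -> daha_eq q (Add x z) (Add y z)
| daha_addr x y z : daha_eq q x y -> daha_eq q (Add z x) (Add z y)
| daha_mull x y z : daha_eq q x y -> daha_eq q (Mul x z) (Mul y z)
| daha_mulr x y z : daha_eq q x y -> daha_eq q (Mul z x) (Mul z y)
| daha_addA x y z : daha_eq q (Add x (Add y z)) (Add (Add x y) z)
| daha_addC x y : daha_eq q (Add x y) (Add y x)
| daha_add0 x : daha_eq q (Add (Cst 0) x) x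
| daha_mulA x y z : daha_eq q (Mul x (Mul y z)) (Mul (Mul x y) z)
| daha_mul1 x : daha_eq q (Mul (Cst 1) x) x
| daha_mul0 x : daha_eq q (Mul (Cst 0) x) (Cst 0)
| daha_mulDl x y z : daha_eq q (Mul (Add x y) z) (Add (Mul x z) (Mul y z))
| daha_mulDr x y z : daha_eq q (Mul x (Add y z)) (Add (Mul x y) (Mul x z))
| daha_cstD a b : daha_eq q (Cst (a + b)) (Add (Cst a) (Cst b))
| daha_cstM a b : daha_eq q (Cst (a * b)) (Mul (Cst a) (Cst b))
| daha_cstC a x : daha_eq q (Mul (Cst a) x) (Mul x (Cst a))
| daha_genK i : daha_eq q (Mul (Gen i) (GenV i)) (Cst 1)
| daha_genVK i : daha_eq q (Mul (GenV i) (Gen i)) (Cst 1)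
| daha_central i x :
    daha_eq q (Mul (Add (Gen i) (GenV i)) x) (Mul x (Add (Gen i) (GenV i)))
| daha_prod :
    daha_eq q (Mul (Mul (Mul (Gen 0) (Gen 1)) (Gen 2)) (Gen 3)) (Cst q^-1).

HB.instance Definition _ (F : Type) := gen_eqMixin (expr F).
HB.instance Definition _ (F : Type) := gen_choiceMixin (expr F).

Section DahaEquiv.
Variables (F : fieldType) (q : F).

Definition daha_eqb : rel (expr F) := fun x y => `[< daha_eq q x y >].

Lemma daha_eqb_refl : reflexive daha_eqb.
Proof. by move=> x; apply/asboolP; exact: daha_refl. Qed.

Lemma daha_eqb_sym : symmetric daha_eqb.
Proof.
by move=> x y; apply/idP/idP => /asboolP h; apply/asboolP; exact: daha_sym.
Qed.

Lemma daha_eqb_trans : transitive daha_eqb.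
Proof.
move=> y x z /asboolP hxy /asboolP hyz; apply/asboolP.
exact: daha_trans hxy hyz.
Qed.

Canonical daha_equiv := EquivRel daha_eqb daha_eqb_refl daha_eqb_sym daha_eqb_trans.

End DahaEquiv.

(* For q = 0 the relations would make the algebra zero (as 0^-1 = 0 in         *)
(* MathComp), which algType excludes; hence the proof of q != 0 as argument.   *)
Definition daha (F : fieldType) (q : F) (q_neq0 : q != 0) : Type :=
  {eq_quot (daha_equiv q)}.

Section DahaQuotient.
Variables (F : fieldType) (q : F) (q_neq0 : q != 0).
Local Notation H := (daha q_neq0).

HB.instance Definition _ := Choice.on H.
HB.instance Definition _ := Quotient.on H.

Definition daha_of (x : expr F) : H := \pi_H x.

Lemma daha_ofP x y : daha_of x = daha_of y <-> daha_eq q x y.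
Proof.
split=> [/eqmodP/asboolP //|h].
by apply/eqmodP/asboolP.
Qed.

Lemma daha_ofK (x : H) : daha_of (repr x) = x.
Proof. exact: reprK. Qed.

Definition hcst (a : F) : H := daha_of (Cst a).
Definition hadd (x y : H) : H := daha_of (Add (repr x) (repr y)).
Definition hmul (x y : H) : H := daha_of (Mul (repr x) (repr y)).
Definition hopp (x : H) : H := hmul (hcst (-1)) x.

Lemma hadd_of x y : hadd (daha_of x) (daha_of y) = daha_of (Add x y).
Proof.
apply/daha_ofP; apply: (@daha_trans _ _ _ (Add x (repr (daha_of y)))).
  by apply: daha_addl; apply/daha_ofP; rewrite daha_ofK.
by apply: daha_addr; apply/daha_ofP; rewrite daha_ofK.
Qed.

Lemma hmul_of x y : hmul (daha_of x) (daha_of y) = daha_of (Mul x y).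
Proof.
apply/daha_ofP; apply: (@daha_trans _ _ _ (Mul x (repr (daha_of y)))).
  by apply: daha_mull; apply/daha_ofP; rewrite daha_ofK.
by apply: daha_mulr; apply/daha_ofP; rewrite daha_ofK.
Qed.

Let hE := (hadd_of, hmul_of).

Lemma haddA : associative hadd.
Proof.
move=> x y z; rewrite -[x]daha_ofK -[y]daha_ofK -[z]daha_ofK !hE.
by apply/daha_ofP; exact: daha_addA.
Qed.

Lemma haddC : commutative hadd.
Proof.
move=> x y; rewrite -[x]daha_ofK -[y]daha_ofK !hE.
by apply/daha_ofP; exact: daha_addC.
Qed.

Lemma hadd0 : left_id (hcst 0) hadd.
Proof.
by move=> x; rewrite -[x]daha_ofK !hE; apply/daha_ofP; exact: daha_add0.
Qed.

Lemma hmulA : associative hmul.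
Proof.
move=> x y z; rewrite -[x]daha_ofK -[y]daha_ofK -[z]daha_ofK !hE.
by apply/daha_ofP; exact: daha_mulA.
Qed.

Lemma hmul1l : left_id (hcst 1) hmul.
Proof.
by move=> x; rewrite -[x]daha_ofK !hE; apply/daha_ofP; exact: daha_mul1.
Qed.

Lemma hcstC a x : hmul (hcst a) x = hmul x (hcst a).
Proof. by rewrite -[x]daha_ofK !hE; apply/daha_ofP; exact: daha_cstC. Qed.

Lemma hmul1r : right_id (hcst 1) hmul.
Proof. by move=> x; rewrite -hcstC hmul1l. Qed.

Lemma hmulDl : left_distributive hmul hadd.
Proof.
move=> x y z; rewrite -[x]daha_ofK -[y]daha_ofK -[z]daha_ofK !hE.
by apply/daha_ofP; exact: daha_mulDl.
Qed.

Lemma hmulDr : right_distributive hmul hadd.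
Proof.
move=> x y z; rewrite -[x]daha_ofK -[y]daha_ofK -[z]daha_ofK !hE.
by apply/daha_ofP; exact: daha_mulDr.
Qed.

Lemma hcstD a b : hcst (a + b) = hadd (hcst a) (hcst b).
Proof. by rewrite hE; apply/daha_ofP; exact: daha_cstD. Qed.

Lemma hcstM a b : hcst (a * b) = hmul (hcst a) (hcst b).
Proof. by rewrite hE; apply/daha_ofP; exact: daha_cstM. Qed.

Lemma haddN : left_inverse (hcst 0) hopp hadd.
Proof.
move=> x; rewrite /hopp -{2}[x]hmul1l -hmulDl -hcstD addNr.
by rewrite -[x]daha_ofK hE; apply/daha_ofP; exact: daha_mul0.
Qed.

Fixpoint eval (A : algType F) (u v : 'I_4 -> A) (x : expr F) : A :=
  match x with
  | Cst a => a%:A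
  | Gen i => u i
  | GenV i => v i
  | Add x y => eval u v x + eval u v y
  | Mul x y => eval u v x * eval u v y
  end.

Section Eval.
Variables (A : algType F) (u v : 'I_4 -> A).
Hypotheses (uK : forall i, u i * v i = 1) (vK : forall i, v i * u i = 1).
Hypothesis uvC : forall i j, GRing.comm (u i + v i) (u j).
Hypothesis uprod : u 0 * u 1 * u 2 * u 3 = (q^-1)%:A.

Lemma eval_central i x : GRing.comm (u i + v i) (eval u v x).
Proof.
elim: x => [a|j|j|x IHx y IHy|x IHx y IHy] /=.
- by rewrite /GRing.comm mulr_algr mulr_algl.
- exact: uvC.
- have h := uvC i j; rewrite /GRing.comm.
  by rewrite -[LHS]mul1r -(vK j) -!mulrA (mulrA (u j)) -h -mulrA uK mulr1.
- exact: commrD.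
- exact: commrM.
Qed.

Lemma eval_sound x y : daha_eq q x y -> eval u v x = eval u v y.
Proof.
elim=> //= {x y}.
- by move=> x y z _ -> _ ->.
- by move=> x y z _ ->.
- by move=> x y z _ ->.
- by move=> x y z _ ->.
- by move=> x y z _ ->.
- by move=> x y z; rewrite addrA.
- by move=> x y; rewrite addrC.
- by move=> x; rewrite scale0r add0r.
- by move=> x y z; rewrite mulrA.
- by move=> x; rewrite scale1r mul1r.
- by move=> x; rewrite scale0r mul0r.
- by move=> x y z; rewrite mulrDl.
- by move=> x y z; rewrite mulrDr.
- by move=> a b; rewrite scalerDl.
- by move=> a b; rewrite -scalerAl mul1r scalerA.
- by move=> a x; rewrite mulr_algr mulr_algl.
- by move=> i; rewrite scale1r.
- by move=> i; rewrite scale1r.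
- by move=> i x; rewrite -/(GRing.comm _ _); exact: eval_central.
Qed.

End Eval.

(* The character t_0 |-> q^-1, t_1, t_2, t_3 |-> 1 shows that 1 != 0. *)
Lemma hone_neq0 : hcst 1 != hcst 0.
Proof.
apply/eqP => /daha_ofP h.
pose u (i : 'I_4) : F^o := if i == 0 then q^-1 else 1.
pose v (i : 'I_4) : F^o := if i == 0 then q else 1.
have := @eval_sound F^o u v _ _ _ _ _ _ h.
rewrite /= scale1r scale0r => /(_ _ _ _ _)/eqP.
rewrite oner_eq0 => h01; suff : false by []; apply: h01.
- by move=> i; rewrite /u /v; case: ifP => _; rewrite ?mulr1 ?mulVf.
- by move=> i; rewrite /u /v; case: ifP => _; rewrite ?mulr1 ?mulfV.
- by move=> i j; exact: mulrC.
- by rewrite /u /= !mulr1; rewrite -[RHS]/(q^-1 * 1) mulr1.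
Qed.

HB.instance Definition _ := GRing.isZmodule.Build H haddA haddC hadd0 haddN.
HB.instance Definition _ :=
  GRing.Zmodule_isNzRing.Build H hmulA hmul1l hmul1r hmulDl hmulDr hone_neq0.

Definition hscale (a : F) (x : H) : H := hcst a * x.

Lemma hscaleA a b x : hscale a (hscale b x) = hscale (a * b) x.
Proof. by rewrite /hscale mulrA -[_ * hcst b]hcstM. Qed.

Lemma hscale1 : left_id 1 hscale.
Proof. exact: hmul1l. Qed.

Lemma hscaleDr : right_distributive hscale +%R.
Proof. by move=> a x y; rewrite /hscale mulrDr. Qed.

Lemma hscaleDl x : {morph hscale^~ x : a b / a + b}.
Proof. by move=> a b; rewrite /hscale hcstD mulrDl. Qed.

HB.instance Definition _ :=
  GRing.Zmodule_isLmodule.Build F H hscaleA hscale1 hscaleDr hscaleDl.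

Lemma hscaleAl (a : F) (x y : H) : a *: (x * y) = (a *: x) * y.
Proof. exact: mulrA. Qed.

HB.instance Definition _ := GRing.Lmodule_isLalgebra.Build F H hscaleAl.

Lemma hscaleAr (a : F) (x y : H) : a *: (x * y) = x * (a *: y).
Proof.
by rewrite -[LHS]/(hcst a * (x * y)) mulrA [hcst a * x]hcstC -mulrA.
Qed.

HB.instance Definition _ := GRing.Lalgebra_isAlgebra.Build F H hscaleAr.

Lemma hcst_alg (a : F) : a%:A = hcst a :> H.
Proof. exact: mulr1. Qed.

Definition daha_t (i : 'I_4) : H := daha_of (Gen i).
Definition daha_tV (i : 'I_4) : H := daha_of (GenV i).

Lemma daha_tK i : daha_t i * daha_tV i = 1.
Proof. by rewrite [LHS]hmul_of; apply/daha_ofP; exact: daha_genK. Qed.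

Lemma daha_tVK i : daha_tV i * daha_t i = 1.
Proof. by rewrite [LHS]hmul_of; apply/daha_ofP; exact: daha_genVK. Qed.

Lemma daha_t_central i x : GRing.comm (daha_t i + daha_tV i) x.
Proof.
rewrite -[x]daha_ofK /GRing.comm [_ + _]hadd_of [LHS]hmul_of [RHS]hmul_of.
by apply/daha_ofP; exact: daha_central.
Qed.

Lemma daha_t_prod : daha_t 0 * daha_t 1 * daha_t 2 * daha_t 3 = (q^-1)%:A.
Proof.
rewrite hcst_alg [_ * daha_t 1]hmul_of [_ * daha_t 2]hmul_of [LHS]hmul_of.
by apply/daha_ofP; exact: daha_prod.
Qed.

Lemma eval_daha x : eval daha_t daha_tV x = daha_of x.
Proof.
elim: x => [a|i|i|x IHx y IHy|x IHx y IHy] //=.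
- exact: hcst_alg.
- by rewrite IHx IHy [LHS]hadd_of.
- by rewrite IHx IHy [LHS]hmul_of.
Qed.

(* With the four relations above, the universal property of the presentation. *)
Lemma daha_universal (A : algType F) (u v : 'I_4 -> A) :
    (forall i, u i * v i = 1) -> (forall i, v i * u i = 1) ->
    (forall i j, GRing.comm (u i + v i) (u j)) ->
    u 0 * u 1 * u 2 * u 3 = (q^-1)%:A ->
  exists! f : H -> A,
    [/\ forall x y, f (x + y) = f x + f y, forall x y, f (x * y) = f x * f y,
        forall a : F, f a%:A = a%:A, f \o daha_t =1 u & f \o daha_tV =1 v].
Proof.
move=> uK vK uvC uprod; have ev := eval_sound uK vK uvC uprod.
have evr x : eval u v (repr (daha_of x)) = eval u v x.
  by apply: ev; apply/daha_ofP; rewrite daha_ofK.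
exists (fun x : H => eval u v (repr x)); split.
  by split=> [x y|x y|a|i|i]; rewrite ?hcst_alg /= evr.
move=> f [fD fM fc ft ftV]; apply: funext => x; rewrite -{2}[x]daha_ofK.
elim: (repr x) => [a|i|i|y IHy z IHz|y IHy z IHz] /=.
- by rewrite -eval_daha /= fc.
- by rewrite -ft.
- by rewrite -ftV.
- by rewrite IHy IHz -fD [_ + _]hadd_of.
- by rewrite IHy IHz -fM [_ * _]hmul_of.
Qed.

End DahaQuotient.

(* A module V over an F-algebra A is a vector space over F via a |-> a%:A. *)
Definition finite_dimensional (F : fieldType) (A : algType F) (V : lmodType A) :
    Prop :=
  exists (n : nat) (e : 'I_n -> V), forall v : V,
    exists c : 'I_n -> F, v = \sum_(i < n) (c i)%:A *: e i.

Definition irreducible_module (R : nzRingType) (V : lmodType R) : Prop :=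
  (exists v : V, v != 0) /\
  forall S : {pred V}, submod_closed S -> S =i pred1 0 \/ S =i predT.

Definition eigenvector (F : fieldType) (A : algType F) (V : lmodType A)
    (x : A) (v : V) : Prop :=
  v != 0 /\ exists a : F, x *: v = a%:A *: v.

Definition simultaneous_eigenvector (F : fieldType) (A : algType F)
    (V : lmodType A) (x y : A) (v : V) : Prop :=
  eigenvector x v /\ eigenvector y v.

(* Main.v *)
Require Import Defs.
From mathcomp Require Import all_boot all_order all_algebra.
From mathcomp Require Import boolp.

Set Implicit Arguments.
Unset Strict Implicit.
Unset Printing Implicit Defensive.

Import GRing.Theory.
Local Open Scope ring_scope.

(** Put Y = t_0 t_1 and Z = t_2 t_3, so that Y Z = Z Y = q^-1. The element
    Y + Y^-1 commutes with t_0 and t_1, because t_0 + t_0^-1 and t_1 + t_1^-1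
    are central. Hence if Y v = l v, then Y + Y^-1 acts as l + l^-1 on both v
    and t_0 v, and (Y - l) t_0 v is killed by Y - l^-1. Either it is nonzero,
    and l^-1 is an eigenvalue of Y, or Y acts as l on the span of v and t_0 v.
    In the second case the span contains an eigenvector of t_0, as t_0 is
    quadratic there, and t_1 = t_0^-1 Y acts on it by a scalar too. This
    dichotomy is [inverse_eigenvalue].

    If t_0 and t_1 have no simultaneous eigenvector, the eigenvalues of Y are
    thus closed under l |-> l^-1; if t_2 and t_3 have none, the same holds for
    those of Z, which are the q^-1 l^-1. When both fail, l |-> l^-1 |-> q^-2 l
    preserves the eigenvalues of Y, and as q is not a root of unity, Y has
    infinitely many of them. That is impossible on a finite-dimensional space,
    where some nonzero polynomial kills Y ([annihilating_polynomial]).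
    Irreducibility enters through Schur's lemma ([central_scalar]), which makes
    t_0 and t_2 quadratic over F. *)

(** * Scalars and eigenvalues in a module over an algebra *)

Section Module.
Variables (F : fieldType) (A : algType F) (V : lmodType A).
Implicit Types (a b : F) (h x y : A) (v w : V) (p : {poly F}).

Definition has_eigenvalue h a :=
  exists2 v : V, v != 0 & h *: v = a%:A *: v.

Lemma scaler_algC h a v : h *: (a%:A *: v) = a%:A *: (h *: v).
Proof. by rewrite !scalerA mulr_algl mulr_algr. Qed.

Lemma scaler_algM a b v : a%:A *: (b%:A *: v) = (a * b)%:A *: v.
Proof. by rewrite scalerA mulr_algl scalerA. Qed.

Lemma scaler_algK a v : a != 0 -> a^-1%:A *: (a%:A *: v) = v.
Proof. by move=> a0; rewrite scaler_algM mulVf // !scale1r. Qed.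

Lemma scaler_alg_eq0 a v : a != 0 -> a%:A *: v = 0 -> v = 0.
Proof. by move=> a0 av; rewrite -(scaler_algK v a0) av scaler0. Qed.

Lemma eigenvalue_neq0 x x' a :
  x' * x = 1 -> has_eigenvalue x a -> a != 0.
Proof.
move=> xV [v v0 xv]; apply: contraNneq v0 => a0.
by rewrite -[v]scale1r -xV -scalerA xv a0 !scale0r scaler0.
Qed.

Lemma inverse_scalar x x' a v :
  x' * x = 1 -> a != 0 -> x *: v = a%:A *: v -> x' *: v = a^-1%:A *: v.
Proof.
move=> xV a0 xv; rewrite -[LHS](scaler_algK _ a0) -(scaler_algC _ a) -xv.
by rewrite (scalerA x') xV scale1r.
Qed.

Lemma eigenvalue_cofactor x y a b :
  x * y = b%:A -> a != 0 -> has_eigenvalue y a -> has_eigenvalue x (b / a).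
Proof.
move=> xy a0 [v v0 yv]; exists v => //.
have: x *: (y *: v) = b%:A *: v by rewrite scalerA xy.
rewrite yv scaler_algC => /(congr1 ( *:%R a^-1%:A)).
by rewrite scaler_algK // scaler_algM mulrC.
Qed.

Lemma horner_alg_eigen h a v p :
  h *: v = a%:A *: v -> horner_alg h p *: v = p.[a]%:A *: v.
Proof.
move=> hv; elim/poly_ind: p => [|p c IHp].
  by rewrite rmorph0 horner0 !scale0r.
rewrite rmorphD rmorphM /= horner_algX horner_algC hornerMXaddC.
rewrite [LHS]scalerDl -scalerA hv scaler_algC IHp scaler_algM.
by rewrite -scalerDl -scalerDl mulrC.
Qed.

Lemma horner_alg_rVpoly n h (u : 'rV[F]_n) v :
  horner_alg h (rVpoly u) *: v = \sum_(k < n) (u 0 k)%:A *: (h ^+ k *: v).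
Proof.
rewrite /rVpoly poly_def rmorph_sum scaler_suml; apply: eq_bigr => k _ /=.
by rewrite valK linearZ /= rmorphXn /= horner_algX -scalerA.
Qed.

(** * Finite-dimensional modules *)

(** The n + 1 vectors w, h w, ..., h^n w lie in the span of n vectors, so they
    satisfy a linear relation. *)
Lemma cyclic_annihilating_polynomial n (e : 'I_n -> V) h w :
    (forall v, exists c : 'I_n -> F, v = \sum_(i < n) (c i)%:A *: e i) ->
  exists2 p : {poly F}, p != 0 & horner_alg h p *: w = 0.
Proof.
move=> espan.
have [c cE] : exists c : 'I_n.+1 -> 'I_n -> F,
    forall k : 'I_n.+1, h ^+ k *: w = \sum_(i < n) (c k i)%:A *: e i.
  exact: (fin_all_exists (fun k : 'I_n.+1 => espan (h ^+ k *: w))).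
pose C : 'M[F]_(n.+1, n) := \matrix_(k, i) c k i.
have /rowV0Pn[u /sub_kermxP uC u0] : kermx C != 0.
  rewrite kermx_eq0 /row_free neq_ltn.
  by rewrite (leq_ltn_trans (rank_leq_col C)).
exists (rVpoly u).
  by apply: contraNneq u0 => u0; rewrite -[u]rVpolyK u0 linear0.
rewrite horner_alg_rVpoly.
transitivity (\sum_(i < n) ((u *m C) 0 i)%:A *: e i); last first.
  by rewrite uC big1 // => i _; rewrite mxE !scale0r.
under eq_bigr => k _ do rewrite cE scaler_sumr.
rewrite exchange_big; apply: eq_bigr => i _ /=.
rewrite mxE !scaler_suml; apply: eq_bigr => k _.
by rewrite scaler_algM mxE.
Qed.

Lemma annihilating_polynomial h :
    finite_dimensional V ->
  exists2 p : {poly F}, p != 0 & forall v, horner_alg h p *: v = 0.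
Proof.
move=> [n [e espan]].
have [p pP] : exists p : 'I_n -> {poly F},
    forall i, p i != 0 /\ horner_alg h (p i) *: e i = 0.
  apply: (fin_all_exists (P := fun i p => p != 0 /\ horner_alg h p *: e i = 0)).
  by move=> i; have [p p0 pe] := cyclic_annihilating_polynomial h (e i) espan;
     exists p.
exists (\prod_i p i); first by apply/prodf_neq0 => i _; case: (pP i).
move=> v; have [c ->] := espan v.
rewrite scaler_sumr big1 // => i _.
rewrite scaler_algC (bigD1 i) //= mulrC rmorphM /= -scalerA.
by rewrite (pP i).2 !scaler0.
Qed.

End Module.

(** * Eigenvectors over an algebraically closed field *)

Section ClosedField.
Variables (F : closedFieldType) (A : algType F) (V : lmodType A).
Implicit Types (a : F) (h x y : A) (v w : V) (p : {poly F}).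

(** Split an annihilating polynomial into linear factors and apply them one by
    one to v: the last nonzero vector on the way is an eigenvector. *)
Lemma eigenvalue_exists h :
    finite_dimensional V -> (exists v : V, v != 0) ->
  exists a, has_eigenvalue V h a.
Proof.
move=> /(annihilating_polynomial h)[p p0 pV] [v v0].
have [r pE] := closed_field_poly_normal p.
have := pV v; rewrite pE linearZ /= -scalerA.
move=> /scaler_alg_eq0; rewrite lead_coef_eq0 => /(_ p0) {p p0 pV pE}.
elim: r v v0 => [|z r IHr] v v0.
  by rewrite big_nil rmorph1 scale1r => v00; rewrite v00 eqxx in v0.
rewrite big_cons mulrC rmorphM /= -scalerA.
have [|w0 /(IHr _ w0)//] := eqVneq (horner_alg h ('X - z%:P) *: v) 0.
rewrite rmorphB /= horner_algX horner_algC scalerBl => /subr0_eq hv _.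
by exists z, v.
Qed.

(** Schur's lemma: an eigenspace of a central element is a submodule. *)
Lemma central_scalar h :
    finite_dimensional V -> irreducible_module V ->
    (forall x, GRing.comm h x) ->
  exists a, forall v : V, h *: v = a%:A *: v.
Proof.
move=> fdV [V0 irrV] hC; have [a [w w0 hw]] := eigenvalue_exists h fdV V0.
exists a => v; apply/eqP.
have S_submod : submod_closed [pred u : V | h *: u == a%:A *: u].
  split=> [|x u u' /eqP hu /eqP hu']; first by rewrite inE !scaler0.
  rewrite inE !scalerDr hu' scalerA (hC x) -scalerA hu.
  by rewrite scaler_algC.
case: (irrV _ S_submod) => [/(_ w)|/(_ v)]; rewrite !inE //.
by rewrite hw eqxx (negPf w0).
Qed.

Lemma eigenvalue_quadratic (c : F) : exists2 a, a != 0 & c = a + a^-1.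
Proof.
have /closed_rootP[a] : size ('X^2 - c *: 'X + 1 : {poly F}) != 1%N.
  rewrite -addrA size_polyDl size_polyXn //.
  rewrite ltnS -scaleNr (leq_trans (size_polyD _ _)) //.
  by rewrite geq_max (leq_trans (size_scale_leq _ _)) ?size_polyX ?size_poly1.
rewrite /root !hornerE => /eqP ha.
have a0 : a != 0.
  apply: contra_eq_neq ha => ->.
  by rewrite expr0n mulr0 subr0 add0r oner_neq0.
exists a => //; apply: (mulIf a0); apply/eqP.
rewrite mulrDl mulVf // -expr2 eq_sym -subr_eq0 addrAC.
by rewrite ha.
Qed.

End ClosedField.

(** * Two invertible elements with central traces *)

(** Conjugation by x turns x y + y' x' into y x + x' y'. Write x' = c - x and
    y' = d - y, where c and d commute with x and y: then both elements equal
    x y + y x - c y - d x + c d. *)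
Lemma trace_prod_comm (R : nzRingType) (x x' y y' : R) :
    x * x' = 1 -> x' * x = 1 ->
    GRing.comm (x + x') (x * y) -> GRing.comm (y + y') x ->
  GRing.comm (x * y + y' * x') x.
Proof.
move=> xK xV xC yC.
have {xC} xC : x * y * x = x * x * y + y - x * y * x'.
  apply/eqP; rewrite eq_sym subr_eq -mulrDr -xC.
  by rewrite mulrDl !mulrA xV mul1r.
have y'x : x * y' = y' * x + y * x - x * y.
  by apply/eqP; rewrite eq_sym subr_eq -mulrDr [y' + y]addrC -yC mulrDl addrC.
rewrite /GRing.comm mulrDl mulrDr !mulrA y'x -[y' * x' * x]mulrA xV mulr1.
rewrite xC mulrBl mulrDl -!(mulrA _ x x') xK !mulr1.
by rewrite -!addrA; congr (_ + _); rewrite [y' + _ in RHS]addrC -!addrA;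
  congr (_ + _); rewrite addrC.
Qed.

Section TwoElements.
Variables (F : closedFieldType) (A : algType F) (V : lmodType A).
Variables (x x' y y' : A).
Hypotheses (xK : x * x' = 1) (xV : x' * x = 1).
Hypotheses (yK : y * y' = 1) (yV : y' * y = 1).
Hypothesis xC : forall h, GRing.comm (x + x') h.
Hypothesis yC : forall h, GRing.comm (y + y') h.

(** As (x - a^-1) (x - a) kills v, one of v and x v - a v is an eigenvector of
    x. Both are eigenvectors of x y, and y = x' (x y). *)
Lemma simultaneous_eigenvector_of_product (a l : F) (v : V) :
    a != 0 -> (x + x') *: v = (a + a^-1)%:A *: v -> v != 0 ->
    (x * y) *: v = l%:A *: v -> (x * y) *: (x *: v) = l%:A *: (x *: v) ->
  exists u : V, simultaneous_eigenvector x y u.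
Proof.
move=> a0 cv v0 Yv Yxv.
have sim (u : V) b : u != 0 -> x *: u = b%:A *: u -> (x * y) *: u = l%:A *: u ->
    simultaneous_eigenvector x y u.
  move=> u0 xu Yu; split; split=> //; first by exists b.
  have b0 : b != 0 by apply: (eigenvalue_neq0 xV); exists u.
  exists (l * b^-1); rewrite -scaler_algM -(inverse_scalar xV b0 xu).
  by rewrite -scaler_algC -Yu scalerA mulrA xV mul1r.
have [xv|u0] := eqVneq (x *: v - a%:A *: v) 0.
  by exists v; apply: (sim v a v0 _ Yv); exact: subr0_eq.
exists (x *: v - a%:A *: v); apply: (sim _ a^-1) => //; last first.
  by rewrite !scalerBr Yxv (scaler_algC (x * y)) Yv (scaler_algC l%:A).
have xxv : x *: (x *: v) = a%:A *: (x *: v) + a^-1%:A *: (x *: v) - v.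
  apply/eqP; rewrite eq_sym subr_eq.
  rewrite -scalerDl -scalerDl -scaler_algC -cv scalerDl scalerDr.
  by rewrite (scalerA x x') xK scale1r.
rewrite !scalerBr scaler_algK // xxv (scaler_algC x).
by rewrite -(addrA (a%:A *: _)) addrAC subrr add0r.
Qed.

Lemma inverse_eigenvalue (c l : F) :
    (forall v : V, (x + x') *: v = c%:A *: v) ->
    has_eigenvalue V (x * y) l ->
  (exists u : V, simultaneous_eigenvector x y u) \/
  has_eigenvalue V (x * y) l^-1.
Proof.
move=> cV Yl; have [v v0 Yv] := Yl.
have [a a0 ca] := eigenvalue_quadratic c.
have YV : (y' * x') * (x * y) = 1 by rewrite mulrA -(mulrA y') xV mulr1.
have YK : (x * y) * (y' * x') = 1 by rewrite mulrA -(mulrA x) yK mulr1.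
have l0 := eigenvalue_neq0 YV Yl.
set w := (x * y) *: (x *: v) - l%:A *: (x *: v).
have [w0|w0] := eqVneq w 0.
  left; apply: (@simultaneous_eigenvector_of_product a l v) => //.
    by rewrite -ca.
  exact: subr0_eq.
right; exists w => //.
have Y'v : (y' * x') *: v = l^-1%:A *: v.
  exact: (inverse_scalar YV l0 Yv).
(* Y + Y^-1, where Y = x y, commutes with x, so it acts on x v by the same
   scalar l + l^-1 as on v. *)
have tr : (x * y) *: (x *: v) + (y' * x') *: (x *: v)
    = l%:A *: (x *: v) + l^-1%:A *: (x *: v).
  rewrite -scalerDl scalerA (trace_prod_comm xK xV (xC _) (yC _)) -scalerA.
  by rewrite scalerDl Yv Y'v scalerDr !scaler_algC.
have wE : w = l^-1%:A *: (x *: v) - (y' * x') *: (x *: v).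
  by apply/eqP; rewrite subr_eq addrAC eq_sym subr_eq tr addrC.
rewrite {1}wE scalerBr scaler_algC (scalerA (x * y) (y' * x')) YK scale1r.
by rewrite /w scalerBr scaler_algK.
Qed.

End TwoElements.

(** * The orbit of an eigenvalue under l |-> q^-2 l *)

Lemma expr_inj_not_unity_root (F : fieldType) (q : F) :
    q != 0 -> (forall n, (0 < n)%N -> ~~ n.-unity_root q) ->
  injective (fun n : nat => q ^+ n).
Proof.
move=> q0 qN m n; wlog mn : m n / (m <= n)%N.
  by move=> W; case/orP: (leq_total m n) => /W // h /esym/h.
rewrite -(subnK mn) exprD => /eqP.
rewrite -{1}[q ^+ m]mul1r (inj_eq (mulIf (expf_neq0 _ q0))).
have [->|nm] := posnP (n - m)%N; first by rewrite add0n.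
by rewrite eq_sym -unity_rootE (negPf (qN _ nm)).
Qed.

Theorem proposition4p5 (F : closedFieldType) (q : F) (q_neq0 : q != 0)
    (q_not_root : forall n : nat, (0 < n)%N -> ~~ n.-unity_root q)
    (V : lmodType (daha q_neq0)) :
  finite_dimensional V -> irreducible_module V ->
  (exists v : V, simultaneous_eigenvector (daha_t q_neq0 0) (daha_t q_neq0 1) v)
  \/
  (exists v : V, simultaneous_eigenvector (daha_t q_neq0 2) (daha_t q_neq0 3) v).
Proof.
move=> fdV irrV; have [V0 _] := irrV.
pose t := daha_t q_neq0; pose t' := daha_tV q_neq0.
have tK i : t i * t' i = 1 := daha_tK q_neq0 i.
have tV i : t' i * t i = 1 := daha_tVK q_neq0 i.
have tC i x : GRing.comm (t i + t' i) x := daha_t_central i x.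
set Y := t 0 * t 1; set Z := t 2 * t 3.
have YV : (t' 1 * t' 0) * Y = 1 by rewrite mulrA -(mulrA (t' 1)) tV mulr1.
have YZ : Y * Z = (q^-1)%:A by rewrite mulrA; exact: daha_t_prod.
have ZY : Z * Y = (q^-1)%:A.
  by rewrite -[Z]mul1r -YV -(mulrA _ Y Z) YZ mulr_algr -scalerAl YV.
have ZV : (t' 3 * t' 2) * Z = 1 by rewrite mulrA -(mulrA (t' 3)) tV mulr1.
have [c0 c0V] := central_scalar fdV irrV (tC 0).
have [c2 c2V] := central_scalar fdV irrV (tC 2).
apply: contrapT => /not_orP[noi noii].
have Yinv l : has_eigenvalue V Y l -> has_eigenvalue V Y l^-1.
  by case/(inverse_eigenvalue (tK 0) (tV 0) (tK 1) (tV 1) (tC 0) (tC 1) c0V).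
have Zinv l : has_eigenvalue V Z l -> has_eigenvalue V Z l^-1.
  by case/(inverse_eigenvalue (tK 2) (tV 2) (tK 3) (tV 3) (tC 2) (tC 3) c2V).
(* The eigenvalues used in turn are l^-1 of Y, q^-1 l of Z, q l^-1 of Z and
   q^-2 l of Y. *)
have Yshift l : has_eigenvalue V Y l -> has_eigenvalue V Y (q^-1 ^+ 2 * l).
  move=> Yl; have Yl' := Yinv l Yl.
  have Zl := eigenvalue_cofactor ZY (eigenvalue_neq0 YV Yl') Yl'.
  have Zl' := Zinv _ Zl.
  have := eigenvalue_cofactor YZ (eigenvalue_neq0 ZV Zl') Zl'.
  by rewrite !invrK mulrA expr2.
have [l Yl] := eigenvalue_exists Y fdV V0.
have l0 := eigenvalue_neq0 YV Yl.
have Yorbit n : has_eigenvalue V Y (q^-1 ^+ (n * 2) * l).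
  elim: n => [|n IHn]; first by rewrite mul1r.
  by rewrite mulSn exprD -mulrA; apply: Yshift.
have [p p0 pV] := annihilating_polynomial Y fdV.
pose rs := mkseq (fun n => q^-1 ^+ (n * 2) * l) (size p).
have /(max_poly_roots p0) : all (root p) rs.
  apply/allP => _ /mapP[n _ ->]; case: (Yorbit n) => v v0 Yv.
  apply: contraNT v0 => /scaler_alg_eq0 p_neq0; apply/eqP/(p_neq0 _ V).
  by rewrite -(horner_alg_eigen _ Yv) pV.
rewrite size_mkseq ltnn => /(_ _)/negP[]//.
rewrite mkseq_uniq // => m n /(mulIf l0).
rewrite !exprVn => /invr_inj /(expr_inj_not_unity_root q_neq0 q_not_root) /eqP.
by rewrite eqn_mul2r => /eqP.
Qed.
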